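(* Let $I$ be a non-empty set and let $E\subseteq\mathbb{R}^I$ be a linear subspace containing all $e_i$ ($i\in I$), endowed with a complete absolute normalised norm $\|\cdot\|_E$ such that $\operatorname{span}\{e_i:i\in I\}$ is dense in $E$. If $(X_i)_{i\in I}$ is a family of Banach spaces such that $\delta(\varepsilon):=\inf_{i\in I}\delta_{\mathrm{uacs}}^{X_i}(\varepsilon)>0$ for every $0<\varepsilon\le 2$, and if $E$ has the property $(u^+)$, then $\bigl[\bigoplus_{i\in I}X_i\bigr]_E$ is uacs.
   Context: Banach spaces are real; $S_X$, $B_X$ denote the unit sphere and closed unit ball of $X$, and $X^*$ its dual. A Banach space $X$ is called uacs if for all sequences $(x_n)$, $(y_n)$ in $S_X$ and $(x_n^* )$ in $S_{X^*}$: $\|x_n+y_n\|\to 2$ and $x_n^*(x_n)\to 1$ imply $x_n^*(y_n)\to 1$. For $0<\varepsilon\le 2$ put $D_X(\varepsilon)=\{(x,y)\in S_X\times S_X:\exists\,x^*\in S_{X^*}\text{ with }x^*(x)=1\text{ and }x^*(y)\le 1-\varepsilon\}$ and $\delta_{\mathrm{uacs}}^X(\varepsilon)=\inf\{1-\|\tfrac{x+y}{2}\|:(x,y)\in D_X(\varepsilon)\}$ (with $\inf\emptyset=+\infty$). For a non-empty set $I$, $e_i\in\mathbb{R}^I$ denotes the characteristic function of $\{i\}$. A norm $\|\cdot\|_E$ on a subspace $E$ of $\mathbb{R}^I$ (with all $e_i\in E$) is absolute if whenever $(a_i)_{i\in I}\in E$, $(b_i)_{i\in I}\in\mathbb{R}^I$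 and $|a_i|=|b_i|$ for all $i\in I$, then $(b_i)_{i\in I}\in E$ and $\|(a_i)_{i\in I}\|_E=\|(b_i)_{i\in I}\|_E$; it is normalised if $\|e_i\|_E=1$ for every $i\in I$. $E'$ denotes the space of all $(c_i)_{i\in I}\in\mathbb{R}^I$ with $\|(c_i)_{i\in I}\|_{E'}:=\sup_{(b_i)\in B_E}\sum_{i\in I}|c_ib_i|<\infty$; under the density assumption it is identified with $E^*$ via $(c_i)\mapsto\bigl((b_i)\mapsto\sum_{i\in I}c_ib_i\bigr)$. $E$ has the property $(u^+)$ if for every $\varepsilon>0$ there is some $\delta>0$ such that for all $(a_i)_{i\in I},(b_i)_{i\in I}\in S_E$ and each $(c_i)_{i\in I}\in S_{E'}=S_{E^*}$: $\sum_{i\in I}a_ic_i=1$ and $\|(a_i+b_i)_{i\in I}\|_E\ge 2(1-\delta)$ imply $\sum_{i\in I}|c_i||a_i-b_i|\le\varepsilon$. For a family $(X_i)_{i\in I}$ of Banach spaces, the absolute sum with respect to $E$ is $\bigl[\bigoplus_{i\in I}X_i\bigr]_E=\{(x_i)_{i\in I}\in\prod_{i\in I}X_i:(\|x_i\|)_{i\in I}\in E\}$ with the norm $\|(x_i)_{i\in I}\|_E=\|(\|x_i\|)_{i\in I}\|_E$; it is a Banach space. *)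

(* Defs.v *)
From HB Require Import structures.
From mathcomp Require Import all_boot all_order all_algebra.
From mathcomp Require Import finmap.
From mathcomp Require Import all_classical all_reals all_analysis.
From mathcomp Require Import ring lra.
From mathcomp.analysis.showcase Require summability.

Set Implicit Arguments.
Unset Strict Implicit.
Unset Printing Implicit Defensive.

Import Order.TTheory GRing.Theory Num.Theory.
Import numFieldNormedType.Exports.

Local Open Scope classical_set_scope.
Local Open Scope ring_scope.

Section uacs.
Context {R : realType}.

Definition dual_norm (X : normedModType R) (f : {linear X -> R^o}) : \bar R :=
  ereal_sup [set `|f x|%:E | x in [set x : X | `|x| <= 1]].

Definition dual_sphere (X : normedModType R) : set {linear X -> R^o} :=
  [set f : {linear X -> R^o} | continuous f /\ dual_norm f = 1%E].

Definition uacs (X : completeNormedModType R) : Prop :=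
  forall (x y : nat -> X) (f : nat -> {linear X -> R^o}),
    (forall n, `|x n| = 1) -> (forall n, `|y n| = 1) ->
    (forall n, dual_sphere (f n)) ->
    `|x n + y n| @[n --> \oo] --> (2 : R) ->
    f n (x n) @[n --> \oo] --> (1 : R) ->
    f n (y n) @[n --> \oo] --> (1 : R).

Definition D_uacs (X : completeNormedModType R) (eps : R) : set (X * X) :=
  [set p | `|p.1| = 1 /\ `|p.2| = 1 /\
    exists2 f : {linear X -> R^o},
      dual_sphere f & f p.1 = 1 /\ f p.2 <= 1 - eps].

Definition delta_uacs (X : completeNormedModType R) (eps : R) : \bar R :=
  ereal_inf [set (1 - `|2^-1 *: (p.1 + p.2)|)%:E | p in @D_uacs X eps].

End uacs.

Definition unit_vec (R : realType) (I : choiceType) (i : I) : I -> R :=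
  fun j => (j == i)%:R.

(* Linear subspaces of R^I with a complete absolute normalised norm. The norm
   is a total function on R^I, but only its values on the carrier matter. *)
Record abs_space (R : realType) (I : choiceType) := AbsSpace {
  carrier :> (I -> R) -> Prop;
  enorm : (I -> R) -> R;
  carrier0 : carrier 0;
  carrierD : forall a b, carrier a -> carrier b -> carrier (a + b);
  carrierZ : forall (k : R) a, carrier a -> carrier (k *: a);
  carrier_unit : forall i, carrier (unit_vec R i);
  ler_enormD : forall a b, carrier a -> carrier b ->
    enorm (a + b) <= enorm a + enorm b;
  enormZ : forall (k : R) a, carrier a -> enorm (k *: a) = `|k| * enorm a;
  enorm0_eq0 : forall a, carrier a -> enorm a = 0 -> a = 0;
  enorm_absolute : forall a b, carrier a -> (forall i, `|a i| = `|b i|) ->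
    carrier b /\ enorm a = enorm b;
  enorm_unit : forall i, enorm (unit_vec R i) = 1;
  enorm_complete : forall u : nat -> I -> R, (forall n, carrier (u n)) ->
    (forall e : R, 0 < e -> exists M, forall m n, (M <= m)%N -> (M <= n)%N ->
       enorm (u m - u n) < e) ->
    exists2 a, carrier a & enorm (u n - a) @[n --> \oo] --> (0 : R)
}.

Section abs_space_notions.
Context {R : realType} {I : choiceType}.
Implicit Types E : abs_space R I.

Definition units_dense E : Prop :=
  forall a, E a -> forall eps : R, 0 < eps ->
    exists (s : seq I) (k : I -> R),
      enorm E (a - \sum_(i <- s) k i *: unit_vec R i) < eps.

(* The norm of E'; a family c lies in E' when it is finite. *)
Definition assoc_norm E (c : I -> R) : \bar R :=
  ereal_sup [set \esum_(i in [set: I]) `|c i * b i|%:E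
            | b in [set b | E b /\ enorm E b <= 1]].

(* The signed sum of a_i c_i is the limit of the net of its finite partial
   sums. *)
Definition u_plus E : Prop :=
  forall eps : R, 0 < eps -> exists2 delta : R, 0 < delta &
    forall a b c : I -> R,
      E a -> enorm E a = 1 -> E b -> enorm E b = 1 -> assoc_norm E c = 1%E ->
      summability.partial_sum (fun i => a i * c i) @ summability.totally
        --> (1 : R) ->
      2 * (1 - delta) <= enorm E (a + b) ->
      (\esum_(i in [set: I]) (`|c i| * `|a i - b i|)%:E <= eps%:E)%E.

End abs_space_notions.

Section abs_space_theory.
Context {R : realType} {I : choiceType} (E : abs_space R I).
Implicit Types a b : I -> R.

Lemma carrierN a : E a -> E (- a).
Proof. by move=> Ea; rewrite -scaleN1r; exact: carrierZ. Qed.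

Lemma carrierB a b : E a -> E b -> E (a - b).
Proof. by move=> Ea Eb; apply: carrierD => //; exact: carrierN. Qed.

Lemma enormN a : E a -> enorm E (- a) = enorm E a.
Proof. by move=> Ea; rewrite -scaleN1r enormZ// normrN1 mul1r. Qed.

Lemma enorm0 : enorm E 0 = 0.
Proof.
by rewrite -(scale0r 0) enormZ ?normr0 ?mul0r//; exact: carrier0.
Qed.

Lemma enorm_ge0 a : E a -> 0 <= enorm E a.
Proof.
move=> Ea; have := ler_enormD Ea (carrierN Ea).
by rewrite subrr enorm0 enormN// => h; lra.
Qed.

Lemma enormC a b : E a -> E b -> enorm E (a - b) = enorm E (b - a).
Proof. by move=> Ea Eb; rewrite -opprB enormN//; exact: carrierB. Qed.

Lemma ler_enorm_sub a b c : E a -> E b -> E c ->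
  enorm E (a - c) <= enorm E (a - b) + enorm E (b - c).
Proof.
move=> Ea Eb Ec; have -> : a - c = (a - b) + (b - c).
  by rewrite addrA subrK.
by apply: ler_enormD; exact: carrierB.
Qed.

Lemma ler_coord a i : E a -> `|a i| <= enorm E a.
Proof.
move=> Ea; pose b := (2 * a i) *: unit_vec R i - a.
have bE j : b j = 2 * a i * (j == i)%:R - a j by [].
have [Eb ab] : E b /\ enorm E a = enorm E b.
  apply: enorm_absolute => // j; rewrite bE.
  have [->|_] := eqVneq j i; first by congr `|_|; rewrite mulr1; ring.
  by rewrite mulr0 sub0r normrN.
have := ler_enormD Ea Eb.
rewrite /b addrC subrK enormZ; last exact: carrier_unit.
by rewrite -/b -ab enorm_unit normrM ger0_norm// => h; lra.
Qed.

Fixpoint dyadic a b (n : nat) : I -> R :=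
  if n is m.+1 then fun i => dyadic a b m i +
    (if 0 <= b i - dyadic a b m i then 1 else -1) * (2^-1 ^+ m.+1 * a i)
  else 0.

(* Absolute norms are monotone; completeness is what puts b in E when I is
   infinite. *)
Lemma enorm_solid a b : E a -> (forall i, `|b i| <= `|a i|) ->
  E b /\ enorm E b <= enorm E a.
Proof.
move=> Ea' ba'; pose a' (i : I) : R := `|a i|.
have [Ea aa'] : E a' /\ enorm E a = enorm E a'.
  by apply: enorm_absolute => // i; rewrite normr_id.
have a0 i : 0 <= a' i by exact: normr_ge0.
have {}ba' i : `|b i| <= a' i by exact: ba'.
rewrite {}aa'; move: a' a0 Ea ba' => {Ea'}a a0 Ea ba.
pose p := dyadic a b.
pose s n := p n.+1 - p n.
have sE n i : s n i =
    (if 0 <= b i - p n i then 1 else -1) * (2^-1 ^+ n.+1 * a i).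
  by rewrite /s -[LHS]/(p n.+1 i - p n i) /= addrAC subrr add0r.
have sP n : E (s n) /\ enorm E (s n) = 2^-1 ^+ n.+1 * enorm E a.
  have Es : E (2^-1 ^+ n.+1 *: a) by exact: carrierZ.
  have [|E1 N1] := @enorm_absolute _ _ E _ (s n) Es.
    move=> i; rewrite sE -[X in `|X| = _]/(2^-1 ^+ n.+1 * a i); case: ifP => _.
      by rewrite mul1r.
    by rewrite mulN1r normrN.
  split=> //; rewrite -N1 enormZ// ger0_norm//.
have pS n : p n.+1 = p n + s n by rewrite /s addrC subrK.
have Ep n : E (p n).
  elim: n => [|n ih]; first exact: carrier0.
  by rewrite pS; apply: carrierD => //; case: (sP n).
have half0 n : 0 <= (2^-1 : R) ^+ n by rewrite exprn_ge0// invr_ge0.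
have pb n i : `|b i - p n i| <= 2^-1 ^+ n * a i.
  elim: n => [|n]; first by rewrite subr0 expr0 mul1r.
  rewrite pS -[(p n + s n) i]/(p n i + s n i) sE exprS.
  set r := b i - p n i => rn.
  have -> : b i - (p n i + (if 0 <= r then 1 else -1) * (2^-1 * 2^-1 ^+ n * a i))
    = r - (if 0 <= r then 1 else -1) * (2^-1 * 2^-1 ^+ n * a i).
    by rewrite /r; ring.
  move: rn; rewrite -mulrA; set t := 2^-1 ^+ n * a i.
  case: (lerP 0 r) => r0.
    by rewrite ger0_norm// => rt; rewrite ler_norml; apply/andP; split; lra.
  by rewrite ltr0_norm// => rt; rewrite ler_norml; apply/andP; split; lra.
have pd n d : enorm E (p (n + d)%N - p n) <=
    (2^-1 ^+ n - 2^-1 ^+ (n + d)) * enorm E a.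
  elim: d => [|d ih].
    by rewrite addn0 !subrr mul0r enorm0.
  rewrite addnS pS addrAC.
  have := ler_enormD (carrierB (Ep (n + d)%N) (Ep n)) (sP (n + d)%N).1.
  rewrite (sP (n + d)%N).2 => /le_trans; apply.
  move: ih; rewrite exprS; set t := 2^-1 ^+ (n + d).
  by set u := 2^-1 ^+ n; nra.
have cvg_half (C : R) : 2^-1 ^+ n * C @[n --> \oo] --> (0 : R).
  rewrite -[X in _ --> X](mul0r C); apply: cvgMl; apply: cvg_expr.
  by rewrite ger0_norm// invf_lt1// ltr1n.
have small (C e : R) : 0 < e -> exists M, forall n, (M <= n)%N -> 2^-1 ^+ n * C < e.
  move=> e0; have /cvgrPdist_lt /(_ _ e0) [M _ hM] := cvg_half C.
  exists M => n Mn; have := hM _ Mn; rewrite /= sub0r normrN.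
  exact: le_lt_trans (ler_norm _).
have pmn n m : (n <= m)%N -> enorm E (p m - p n) <= 2^-1 ^+ n * enorm E a.
  move=> nm; rewrite -(subnKC nm); apply: (le_trans (pd _ _)).
  by rewrite ler_wpM2r ?enorm_ge0// gerBl.
have [c Ec pc] : exists2 c, E c & enorm E (p n - c) @[n --> \oo] --> (0 : R).
  apply: enorm_complete => // e e0.
  have [M hM] := small (enorm E a) _ e0.
  exists M => m n Mm Mn; have [nm|/ltnW mn] := leqP n m.
    exact: le_lt_trans (pmn _ _ nm) (hM _ Mn).
  by rewrite enormC//; exact: le_lt_trans (pmn _ _ mn) (hM _ Mm).
have cb : c = b.
  apply/funext => i; apply/eqP; rewrite -subr_eq0 -normr_le0.
  apply/ler_addgt0Pl => e e0; rewrite addr0.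
  have e20 : 0 < e / 2 by rewrite divr_gt0.
  have [M hM] := small (a i) _ e20.
  have /cvgrPdist_lt /(_ _ e20) [M' _ hM'] := pc.
  have := hM' (maxn M M') (leq_maxr _ _).
  have := hM (maxn M M') (leq_maxl _ _).
  set n := maxn M M' => h1; rewrite /= sub0r normrN.
  move/(le_lt_trans (ler_norm _))/(le_lt_trans (ler_coord i (carrierB (Ep n) Ec))).
  rewrite -[(p n - c) i]/(p n i - c i) => h2.
  have := pb n i => h3.
  have -> : c i - b i = - (p n i - c i) - (b i - p n i) by ring.
  by apply: (le_trans (ler_normB _ _)); rewrite normrN; lra.
rewrite -cb; split=> //; apply/ler_addgt0Pl => e e0.
have /cvgrPdist_lt /(_ _ e0) [M _ /(_ M (leqnn _))] := pc.
rewrite /= sub0r normrN => /(le_lt_trans (ler_norm _)) h.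
have := pd 0%N M; rewrite add0n subr0 expr0 => h2.
have := ler_enormD (carrierB Ec (Ep M)) (Ep M).
rewrite subrK enormC// => h3.
have := half0 M; have := enorm_ge0 Ea; nra.
Qed.

End abs_space_theory.

Section abs_sum.
Context {R : realType} {I : choiceType}.
Variables (E : abs_space R I) (X : I -> completeNormedModType R).

Record abs_sum := AbsSum {
  fam :> forall i, X i;
  fam_carrier : E (fun i => `|fam i|)
}.

Implicit Types x y z : abs_sum.

Lemma abs_sum_eq x y : (forall i, x i = y i) -> x = y.
Proof.
case: x y => [x Ex] [y Ey] /= xy.
have {}xy : x = y by apply: functional_extensionality_dep.
by move: Ey; rewrite -xy => Ey; congr AbsSum; exact: Prop_irrelevance.
Qed.

Definition abs_sum_norm x : R := enorm E (fun i => `|x i|).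

Lemma abs_sum_add_subproof x y : E (fun i => `|x i + y i|).
Proof.
have [] // := @enorm_solid _ _ E ((fun i => `|x i|) + (fun i => `|y i|))
  (fun i => `|x i + y i|).
  by apply: carrierD; exact: fam_carrier.
move=> i; rewrite normr_id (le_trans (ler_normD _ _))//.
by rewrite -[X in _ <= `|X|]/(`|x i| + `|y i|) ler_norm.
Qed.

Lemma abs_sum_scale_subproof (k : R) x : E (fun i => `|k *: x i|).
Proof.
have := carrierZ `|k| (fam_carrier x); congr carrier.
by apply/funext => i; rewrite normrZ.
Qed.

Lemma abs_sum_opp_subproof x : E (fun i => `|- x i|).
Proof.
have := fam_carrier x; congr carrier.
by apply/funext => i; rewrite normrN.
Qed.

Lemma abs_sum_zero_subproof : E (fun i => `|0 : X i|).
Proof.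
have := carrier0 E; congr carrier.
by apply/funext => i; rewrite normr0.
Qed.

Definition abs_sum_add x y := AbsSum (abs_sum_add_subproof x y).
Definition abs_sum_scale k x := AbsSum (abs_sum_scale_subproof k x).
Definition abs_sum_opp x := AbsSum (abs_sum_opp_subproof x).
Definition abs_sum_zero := AbsSum abs_sum_zero_subproof.

HB.instance Definition _ := gen_eqMixin abs_sum.
HB.instance Definition _ := gen_choiceMixin abs_sum.

Lemma abs_sum_addA : associative abs_sum_add.
Proof. by move=> x y z; apply: abs_sum_eq => i /=; rewrite addrA. Qed.

Lemma abs_sum_addC : commutative abs_sum_add.
Proof. by move=> x y; apply: abs_sum_eq => i /=; rewrite addrC. Qed.

Lemma abs_sum_add0 : left_id abs_sum_zero abs_sum_add.
Proof. by move=> x; apply: abs_sum_eq => i /=; rewrite add0r. Qed.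

Lemma abs_sum_addN : left_inverse abs_sum_zero abs_sum_opp abs_sum_add.
Proof. by move=> x; apply: abs_sum_eq => i /=; rewrite addNr. Qed.

HB.instance Definition _ := GRing.isZmodule.Build abs_sum
  abs_sum_addA abs_sum_addC abs_sum_add0 abs_sum_addN.

Lemma abs_sum_scaleA k l x :
  abs_sum_scale k (abs_sum_scale l x) = abs_sum_scale (k * l) x.
Proof. by apply: abs_sum_eq => i /=; rewrite scalerA. Qed.

Lemma abs_sum_scale1 : left_id 1 abs_sum_scale.
Proof. by move=> x; apply: abs_sum_eq => i /=; rewrite scale1r. Qed.

Lemma abs_sum_scaleDr : right_distributive abs_sum_scale +%R.
Proof. by move=> k x y; apply: abs_sum_eq => i /=; rewrite scalerDr. Qed.

Lemma abs_sum_scaleDl x : {morph abs_sum_scale^~ x : k l / k + l}.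
Proof. by move=> k l; apply: abs_sum_eq => i /=; rewrite scalerDl. Qed.

HB.instance Definition _ := GRing.Zmodule_isLmodule.Build R abs_sum
  abs_sum_scaleA abs_sum_scale1 abs_sum_scaleDr abs_sum_scaleDl.

Lemma abs_sum_ler_normD x y :
  abs_sum_norm (x + y) <= abs_sum_norm x + abs_sum_norm y.
Proof.
apply: (le_trans _ (ler_enormD (fam_carrier x) (fam_carrier y))).
have [] // := @enorm_solid _ _ E ((fun i => `|x i|) + (fun i => `|y i|))
  (fun i => `|x i + y i|).
  by apply: carrierD; exact: fam_carrier.
move=> i; rewrite normr_id (le_trans (ler_normD _ _))//.
by rewrite -[X in _ <= `|X|]/(`|x i| + `|y i|) ler_norm.
Qed.

Lemma abs_sum_normrZ (k : R) x : abs_sum_norm (k *: x) = `|k| * abs_sum_norm x.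
Proof.
rewrite /abs_sum_norm -[in RHS](normr_id k) -enormZ; last exact: fam_carrier.
by congr enorm; apply/funext => i /=; rewrite normrZ.
Qed.

Lemma abs_sum_normr0_eq0 x : abs_sum_norm x = 0 -> x = 0.
Proof.
move/(enorm0_eq0 (fam_carrier x)) => x0; apply: abs_sum_eq => i.
by apply/eqP; rewrite -normr_eq0; apply/eqP; exact: (congr1 (@^~ i) x0).
Qed.

HB.instance Definition _ := Lmodule_isNormed.Build R abs_sum
  abs_sum_ler_normD abs_sum_normrZ abs_sum_normr0_eq0.

Lemma abs_sum_normE x : `|x| = enorm E (fun i => `|x i|).
Proof. by []. Qed.

Lemma abs_sumBE x y i : (x - y) i = x i - y i.
Proof. by []. Qed.

Lemma ler_abs_sum_coord x i : `|x i| <= `|x|.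
Proof.
by have := ler_coord i (fam_carrier x); rewrite normr_id.
Qed.

Lemma abs_sum_dist_solid x y :
  enorm E ((fun i => `|x i|) - (fun i => `|y i|)) <= `|x - y|.
Proof.
have [] // := @enorm_solid _ _ E (fun i => `|(x - y) i|)
  ((fun i => `|x i|) - (fun i => `|y i|)); first exact: fam_carrier.
by move=> i; rewrite normr_id; exact: ler_dist_dist.
Qed.

Lemma cvg_abs_sum_norms (u : nat -> abs_sum) (z : forall i, X i) :
  (forall e, 0 < e -> exists M, forall m n, (M <= m)%N -> (M <= n)%N ->
     `|u m - u n| < e) ->
  (forall i, u n i @[n --> \oo] --> z i) ->
  E (fun i => `|z i|) /\
  enorm E ((fun i => `|u n i|) - (fun i => `|z i|)) @[n --> \oo] --> (0 : R).
Proof.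
move=> cu uz.
have [c Ec uc] : exists2 c, E c &
    enorm E ((fun i => `|u n i|) - c) @[n --> \oo] --> (0 : R).
  apply: enorm_complete => [n|e e0]; first exact: fam_carrier.
  have [M hM] := cu _ e0; exists M => m n Mm Mn.
  exact: le_lt_trans (abs_sum_dist_solid _ _) (hM _ _ Mm Mn).
suff <- : c = (fun i => `|z i|) by [].
apply/funext => i.
have cz : `|u n i| @[n --> \oo] --> (`|z i| : R) by apply: cvg_norm; exact: uz.
suff cc : `|u n i| @[n --> \oo] --> (c i : R).
  exact: (cvg_unique (@Rhausdorff R) cc cz).
apply/cvgrPdist_lt => e e0.
have /cvgrPdist_lt /(_ _ e0) := uc; apply: filterS => n.
rewrite sub0r normrN => /(le_lt_trans (ler_norm _)); apply: le_lt_trans.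
rewrite distrC; apply: (@ler_coord _ _ E ((fun i => `|u n i|) - c)).
by apply: carrierB => //; exact: fam_carrier.
Qed.

Lemma abs_sum_seq_complete (u : nat -> abs_sum) :
  (forall e, 0 < e -> exists M, forall m n, (M <= m)%N -> (M <= n)%N ->
     `|u m - u n| < e) ->
  exists x, u n @[n --> \oo] --> x.
Proof.
move=> cu.
have cvgi i : cvg (u n i @[n --> \oo]).
  apply/cauchy_cvgP/cauchy_exP => e e0.
  have [M hM] := cu _ e0.
  exists (u M i); exists M => //= n Mn; rewrite -ball_normE /=.
  exact: le_lt_trans (ler_abs_sum_coord (u M - u n) i) (hM _ _ (leqnn _) Mn).
pose z i := lim (u n i @[n --> \oo]).
have [Ez _] := cvg_abs_sum_norms cu cvgi.
exists (AbsSum Ez : abs_sum); apply/cvgrPdist_lt => e e0.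
have e20 : 0 < e / 2 by rewrite divr_gt0.
have [M hM] := cu _ e20.
exists M => //= n Mn.
have [//||Ed cd] := @cvg_abs_sum_norms (fun m => u m - u n) (fun i => z i - u n i).
- move=> e' e'0; have [M' hM'] := cu _ e'0; exists M' => m k Mm Mk.
  by rewrite opprB addrA subrK; exact: hM'.
- by move=> i; apply: cvgB; [exact: cvgi|exact: cvg_cst].
have /cvgrPdist_lt /(_ _ e20) [M' _ /(_ _ (leq_maxr M M'))] := cd.
set m := maxn M M' => /=.
rewrite sub0r normrN => /(le_lt_trans (ler_norm _)) h.
have := hM m n (leq_maxl _ _) Mn; rewrite abs_sum_normE => h'.
rewrite abs_sum_normE.
have Ew := fam_carrier (u m - u n).
have := ler_enormD Ew (carrierB Ed Ew); rewrite addrC subrK enormC//.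
move=> h3; apply: (le_lt_trans h3).
by rewrite (splitr e) ltrD.
Qed.

Lemma abs_sum_complete (F : set_system abs_sum) :
  ProperFilter F -> cauchy F -> cvg F.
Proof.
move=> FF /cauchyP Fc.
have /choice [u hu] (n : nat) : exists x, F (ball x (n.+1%:R^-1 : R)).
  by apply: Fc; rewrite invr_gt0.
have inv_small (e : R) : 0 < e ->
    exists M : nat, forall n, (M <= n)%N -> n.+1%:R^-1 < e.
  move=> e0; have := @cvg_harmonic R.
  move=> /cvgrPdist_lt /(_ _ e0) [M _ hM]; exists M => n Mn.
  by have := hM _ Mn; rewrite /= sub0r normrN ger0_norm.
have [e e0|x ux] := @abs_sum_seq_complete u.
  have e20 : 0 < e / 2 by rewrite divr_gt0.
  have [M hM] := inv_small _ e20; exists M => m n Mm Mn.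
  have [y []] := filter_ex (filterI (hu m) (hu n)).
  rewrite -!ball_normE /= => h1 h2.
  have -> : u m - u n = (u m - y) - (u n - y) by rewrite opprB addrA subrK.
  apply: (le_lt_trans (ler_normB _ _)); rewrite (splitr e).
  by apply: ltrD; [apply: lt_trans h1 _|apply: lt_trans h2 _]; exact: hM.
apply/cvg_ex; exists x; apply/cvgrPdist_lt => e e0.
have e20 : 0 < e / 2 by rewrite divr_gt0.
have [M hM] := inv_small _ e20.
have /cvgrPdist_lt /(_ _ e20) [M' _ hM'] := ux.
have := hM' _ (leq_maxr M M'); have := hM _ (leq_maxl M M').
set n := maxn M M' => h1 h2.
apply: filterS (hu n) => y; rewrite -ball_normE /= => h3.
have -> : x - y = (x - u n) + (u n - y) by rewrite addrA subrK.
apply: (le_lt_trans (ler_normD _ _)); rewrite (splitr e).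
by apply: ltrD => //; exact: lt_trans h3 h1.
Qed.

HB.instance Definition _ := Uniform_isComplete.Build abs_sum abs_sum_complete.

End abs_sum.

(* Main.v *)
Require Import Defs.
From HB Require Import structures.
From mathcomp Require Import all_boot all_order all_algebra.
From mathcomp Require Import finmap.
From mathcomp Require Import all_classical all_reals all_analysis.
From mathcomp Require Import ring lra.
From mathcomp.analysis.showcase Require summability.

Set Implicit Arguments.
Unset Strict Implicit.
Unset Printing Implicit Defensive.

Import Order.TTheory GRing.Theory Num.Theory.
Import numFieldNormedType.Exports.

Local Open Scope classical_set_scope.
Local Open Scope ring_scope.

(** The proof works with pairs [x], [f] where [f] attains its norm at [x], and
    goes back to almost norming functionals at the end.

    Attained case.  Let [x], [y] be unit vectors of the sum and [f] a norm-one
    functional with [f x = 1] and [|x + y|] close to [2].  Restricting [f] to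
    the summands gives functionals [f_i] of norms [c_i], and by density of the
    finitely supported families [f w] is a limit of finite sums of
    [f_i (w_i)].  The family [c] lies in the unit ball of [E']
    ([opnorm_coord_assoc_ball]), so [1 = f x <= sum c_i |x_i| <= 1] and hence
    [f_i (x_i) = c_i |x_i|] for every [i] ([coord_fun_norming]).  Inside a
    single summand, the common modulus [d] of the [X_i] yields
    [c_i |x_i| - f_i (y_i) <=
       c_i (||x_i| - |y_i|| + eps |y_i| + (|x_i| + |y_i| - |x_i + y_i|) / d)]
    ([le_opnorm_defect]).  It remains to sum the three terms.  The second sums
    to at most [eps].  The first is small by [(u^+)] applied to the families
    [|x_i|] and [|y_i|].  For the third, [(u^+)] is applied to [|x_i|] and the
    normalisation of [b' = (|x_i + y_i| - |x_i|)], which is almost a unit vector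
    with [|x_i| + b'_i = |x_i + y_i|] ([enorm_add_normalise]); so [b'] is close
    to [|x_i|] in the seminorm weighted by [c], and so is [|y_i|].  Thus
    [1 - f y] is small.

    General case.  If [f x] is only close to [1], replace [f] by a functional
    supporting the norm at [x - t y] for a small [t]
    ([attaining_perturbation]).  Existence of supporting functionals is
    Hahn-Banach at a point, obtained from Zorn's lemma in the form: a minimal
    sublinear functional is linear ([sublinear_support]). *)

(** * Norming functionals *)

Section sublinear.
Context {R : realType} {V : lmodType R}.
Implicit Types (q p : V -> R) (x y z : V).

Definition sublinear q := (forall x y, q (x + y) <= q x + q y) /\
  (forall (k : R) x, 0 <= k -> q (k *: x) <= k * q x).

Lemma sublinear0 q : sublinear q -> q 0 = 0.
Proof.
move=> [qD qZ]; have := qD 0 0; have := qZ 0 0 (lexx _).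
rewrite scale0r mul0r addr0 => ? ?.
by apply/eqP; rewrite eq_le; apply/andP; split; lra.
Qed.

Lemma sublinearZ q (k : R) x : sublinear q -> 0 <= k -> q (k *: x) = k * q x.
Proof.
move=> sq k0; apply/eqP; rewrite eq_le sq.2//=.
have [->|kN0] := eqVneq k 0; first by rewrite scale0r mul0r (sublinear0 sq).
have {kN0}k0 : 0 < k by rewrite lt_neqAle eq_sym kN0.
have := sq.2 k^-1 (k *: x); rewrite scalerA mulVf ?gt_eqF// scale1r.
by rewrite invr_ge0 ler_pdivlMl// => -> //; exact: ltW.
Qed.

Lemma sublinearN q x : sublinear q -> - q (- x) <= q x.
Proof.
move=> sq; have := sq.1 x (- x); rewrite subrr (sublinear0 sq) => ?; lra.
Qed.

(** The largest sublinear functional below [q] whose value at [- y] is at most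
    [- q y]: each bound in the infimum follows from
    [x = (x + t y) + t (- y)]. *)
Definition lower q y x : R :=
  inf [set q (x + t *: y) - t * q y | t in [set t : R | 0 <= t]].

Section lower.
Variables (q : V -> R) (sq : sublinear q) (y : V).

Let S x := [set q (x + t *: y) - t * q y | t in [set t : R | 0 <= t]].

Let S_lb x : lbound (S x) (- q (- x)).
Proof.
move=> _ [t /= t0 <-]; have := sq.1 (x + t *: y) (- x); have := sublinearZ y sq t0.
by rewrite addrAC subrr add0r => -> ?; lra.
Qed.

Lemma lower_le_ray (t : R) x : 0 <= t -> lower q y x <= q (x + t *: y) - t * q y.
Proof. by move=> t0; apply: ge_inf; [exists (- q (- x)); exact: S_lb|exists t]. Qed.

Lemma lower_ge (m : R) x : (forall t, 0 <= t -> m <= q (x + t *: y) - t * q y) ->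
  m <= lower q y x.
Proof.
move=> mt; apply: lb_le_inf; first by exists (q (x + 0 *: y) - 0 * q y); exists 0 => /=.
by move=> _ [t /= t0 <-]; exact: mt.
Qed.

Lemma lower_le x : lower q y x <= q x.
Proof. by have := lower_le_ray x (lexx 0); rewrite scale0r mul0r addr0 subr0. Qed.

Lemma lower_opp : lower q y (- y) <= - q y.
Proof.
have := lower_le_ray (- y) ler01.
by rewrite scale1r addNr (sublinear0 sq) mul1r sub0r.
Qed.

Lemma lower_sublinear : sublinear (lower q y).
Proof.
split=> [x x'|k x k0].
  rewrite -lerBlDr; apply: lower_ge => t t0.
  rewrite lerBlDr -lerBlDl; apply: lower_ge => s s0.
  rewrite lerBlDl; apply: (le_trans (lower_le_ray _ (addr_ge0 t0 s0))).
  have := sq.1 (x + t *: y) (x' + s *: y).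
  by rewrite addrACA -scalerDl => h; lra.
have [->|kN0] := eqVneq k 0.
  rewrite scale0r mul0r; apply: (le_trans (lower_le _)).
  by rewrite sublinear0.
have {kN0}k0 : 0 < k by rewrite lt_neqAle eq_sym kN0.
rewrite mulrC -ler_pdivrMr//; apply: lower_ge => t t0; rewrite ler_pdivrMr//.
apply: (le_trans (lower_le_ray _ (mulr_ge0 (ltW k0) t0))).
rewrite -scalerA -scalerDr; have := sq.2 k (x + t *: y) (ltW k0).
by move=> h; lra.
Qed.

End lower.

(** Zorn applies to the sublinear functionals below [p] because the pointwise
    infimum of a chain of them is again sublinear; it is finite since all of
    them are bounded below by [- p (- x)] at [x]. *)
Lemma minimal_sublinear p : sublinear p -> exists q, [/\ sublinear q,
  (forall x, q x <= p x) &
  forall q', sublinear q' -> (forall x, q' x <= q x) -> q' = q].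
Proof.
move=> sp.
pose T := {q : V -> R | sublinear q /\ forall x, q x <= p x}.
pose le_rel : rel T := fun s t => `[< forall x, sval t x <= sval s x >].
have [|r s t /asboolP rs /asboolP st|s t /asboolP st /asboolP ts|A totA|[q [sq qp]] qmin] :=
    @Zorn T le_rel.
- by move=> t; apply/asboolP.
- by apply/asboolP => x; exact: le_trans (st x) (rs x).
- case: s t st ts => [s ps] [t pt] /= st ts; apply: eq_exist.
  by apply/funext => x; apply/eqP; rewrite eq_le st ts.
- have [[s0 As0]|A0] := pselect (A !=set0); last first.
    exists (exist _ p (conj sp (fun x => lexx _))) => s As.
    by case: A0; exists s.
  pose q x := inf [set sval s x | s in A].
  have Alb x : has_lbound [set sval s x | s in A].
    exists (- p (- x)) => _ [s As <-]; have [ss sp'] := svalP s.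
    by apply: le_trans (sublinearN x ss); rewrite lerN2.
  have q_le s x : A s -> q x <= sval s x by move=> As; apply: ge_inf => //; exists s.
  have q_ge m x : (forall s, A s -> m <= sval s x) -> m <= q x.
    by move=> h; apply: lb_le_inf; [exists (sval s0 x), s0|move=> _ [s As <-]; exact: h].
  have sq : sublinear q.
    split=> [x y|k x k0].
      rewrite -lerBlDr; apply: (q_ge) => s As; rewrite lerBlDr -lerBlDl.
      apply: (q_ge) => t At; rewrite lerBlDl.
      (* of two members of a chain the smaller one bounds both values *)
      have [/asboolP st|/asboolP ts] := totA _ _ As At.
        apply: (le_trans (q_le t _ At)); have := (svalP t).1.1 x y.
        by have := st x => ? ?; lra.
      apply: (le_trans (q_le s _ As)); have := (svalP s).1.1 x y.
      by have := ts y => ? ?; lra.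
    have [->|kN0] := eqVneq k 0.
      rewrite scale0r mul0r; apply: (le_trans (q_le s0 _ As0)).
      by rewrite (sublinear0 (svalP s0).1).
    have {}k0 : 0 < k by rewrite lt_neqAle eq_sym kN0.
    rewrite mulrC -ler_pdivrMr//; apply: (q_ge) => s As; rewrite ler_pdivrMr//.
    apply: (le_trans (q_le s _ As)).
    by rewrite mulrC; exact: (svalP s).1.2 _ _ (ltW k0).
  have qp x : q x <= p x by exact: le_trans (q_le _ x As0) ((svalP s0).2 x).
  by exists (exist _ q (conj sq qp)) => s As; apply/asboolP => x; exact: q_le.
- exists q; split=> // q' sq' q'q.
  have q'p x : q' x <= p x by exact: le_trans (q'q x) (qp x).
  by have /(congr1 sval) := qmin (exist _ q' (conj sq' q'p)) (asboolT q'q).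
Qed.

(** Minimality gives [lower q y = q], and the term [t = 1] of the infimum
    defining [lower q y x] then reads [q x <= q (x + y) - q y]. *)
Lemma minimal_sublinear_add q : sublinear q ->
  (forall q', sublinear q' -> (forall x, q' x <= q x) -> q' = q) ->
  forall x y, q (x + y) = q x + q y.
Proof.
move=> sq qmin x y; apply/eqP; rewrite eq_le sq.1 /=.
rewrite -lerBrDr; have := lower_le_ray sq y x ler01; rewrite scale1r mul1r.
by rewrite (qmin _ (lower_sublinear sq y) (lower_le sq y)).
Qed.

Lemma additive_sublinear_scale q : sublinear q ->
  (forall x y, q (x + y) = q x + q y) -> forall k x, q (k *: x) = k * q x.
Proof.
move=> sq qD k x.
have qN z : q (- z) = - q z.
  by apply/eqP; rewrite -addr_eq0 addrC -qD subrr (sublinear0 sq).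
have [k0|k0] := lerP 0 k; first exact: sublinearZ.
by rewrite -[k in LHS]opprK scaleNr qN (sublinearZ _ sq) ?oppr_ge0 ?ltW// mulNr opprK.
Qed.

Lemma linear_of_fun (f : V -> R) : (forall x y, f (x + y) = f x + f y) ->
  (forall k x, f (k *: x) = k * f x) ->
  exists g : {linear V -> R^o}, forall x, g x = f x.
Proof.
move=> fD fZ.
have fL : linear (f : V -> R^o) by move=> k x y; rewrite fD fZ.
by exists (HB.pack_for {linear V -> R^o} (f : V -> R^o)
  (GRing.isLinear.Build R V R^o *:%R (f : V -> R^o) fL)).
Qed.

(** Hahn-Banach at a point: the minimal functional below [lower p z] is
    linear, and [lower p z (- z) <= - p z] forces the value [p z] at [z]. *)
Lemma sublinear_support p z : sublinear p ->
  exists g : {linear V -> R^o}, (forall x, g x <= p x) /\ g z = p z.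
Proof.
move=> sp; have [q [sq qp qmin]] := minimal_sublinear (lower_sublinear sp z).
have qD := minimal_sublinear_add sq qmin.
have qZ := additive_sublinear_scale sq qD.
have [g gq] := linear_of_fun qD qZ.
have gp x : g x <= p x.
  by rewrite gq (le_trans (qp x))//; exact: lower_le.
exists g; split=> //; apply/eqP; rewrite eq_le gp/= -lerN2 -linearN gq.
exact: le_trans (qp _) (lower_opp sp z).
Qed.

End sublinear.

Section dual.
Context {R : realType}.

Section functional.
Variable X : normedModType R.
Implicit Types (f : {linear X -> R^o}) (x : X).

Lemma le_norm_abs f (c : R) : (forall x, f x <= c * `|x|) ->
  forall x, `|f x| <= c * `|x|.
Proof.
move=> fc x; rewrite ler_norml fc andbT lerNl.
by rewrite -[- f x]/(- (f x : R^o)) -linearN (le_trans (fc _))// normrN.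
Qed.

Lemma bounded_functional_continuous f (c : R) :
  (forall x, f x <= c * `|x|) -> continuous f.
Proof.
move=> /le_norm_abs fc; apply/linear_bounded_continuous/bounded_funP => r.
exists (`|c| * r) => x xr; apply: (le_trans (fc x)).
apply: le_trans (ler_wpM2r (normr_ge0 _) (ler_norm c)) _.
exact: ler_wpM2l.
Qed.

(** One-sided bounds suffice because the ball is symmetric. *)
Lemma dual_sphereP f : dual_sphere f <-> (forall x, f x <= `|x|) /\
  (forall e : R, 0 < e -> exists2 x, `|x| <= 1 & 1 - e < f x).
Proof.
split=> [[_ f1]|[f_le f_ge]].
  have ball_le x : `|x| <= 1 -> `|f x| <= 1.
    by move=> x1; rewrite -lee_fin -f1; apply: ereal_sup_ubound; exists x.
  split=> [x|e e0].
    have [->|x0] := eqVneq x 0; first by rewrite linear0 normr0.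
    have nx0 : 0 < `|x| by rewrite normr_gt0.
    have := ball_le (`|x|^-1 *: x); rewrite normrZ normfV normr_id mulVf ?gt_eqF//.
    move=> /(_ (lexx _)) /(le_trans (ler_norm _)).
    by rewrite linearZ /= -[_ *: _]/(_ * _) mulrC ler_pdivrMr// mul1r.
  have : ((1 - e)%:E < dual_norm f)%E by rewrite f1 lte_fin; lra.
  move=> /ereal_sup_gt [_ [x /= x1 <-]]; rewrite lte_fin => efx.
  have [fx0|fx0] := lerP 0 (f x); first by exists x; rewrite // -(ger0_norm fx0).
  exists (- x); first by rewrite normrN.
  by rewrite linearN -[X in _ < X]/(- f x) -(ltr0_norm fx0).
have fle x : `|f x| <= `|x|.
  by rewrite -(mul1r `|x|); apply: le_norm_abs => z; rewrite mul1r.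
split.
  by apply: (@bounded_functional_continuous _ 1) => x; rewrite mul1r.
apply/eqP; rewrite eq_le; apply/andP; split.
  by apply: ge_ereal_sup => _ [x /= x1 <-]; rewrite lee_fin (le_trans (fle x)).
apply/lee_addgt0Pr => e e0.
have [x x1 efx] := f_ge _ e0.
rewrite -leeBlDr// -EFinB; apply: (@le_trans _ _ `|f x|%:E).
  by rewrite lee_fin (le_trans (ltW efx))// ler_norm.
by apply: ereal_sup_ubound; exists x.
Qed.

Lemma dual_sphere_le f x : dual_sphere f -> f x <= `|x|.
Proof. by move=> /dual_sphereP[]. Qed.

Lemma dual_sphere_attain f z : (forall x, f x <= `|x|) -> `|z| = 1 -> f z = 1 ->
  dual_sphere f.
Proof.
move=> fle z1 fz; apply/dual_sphereP; split=> // e e0.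
by exists z; rewrite ?z1 ?fz //; lra.
Qed.

Lemma norming_functional (z : X) : z != 0 ->
  exists2 f, dual_sphere f & f z = `|z|.
Proof.
move=> z0; have nz0 : 0 < `|z| by rewrite normr_gt0.
have [|f [fle fz]] := @sublinear_support R X (fun x => `|x|) z.
  by split=> [|k x k0]; [exact: ler_normD|rewrite normrZ ger0_norm].
exists f => //; apply: (@dual_sphere_attain _ (`|z|^-1 *: z)) => //.
  by rewrite normrZ normfV normr_id mulVf ?gt_eqF.
by rewrite linearZ /= fz -[_ *: _]/(_ * _) mulVf ?gt_eqF.
Qed.

End functional.

(** * Reduction to functionals that attain their norm *)

(** A one-sided substitute for the Bishop-Phelps-Bollobas theorem: an almost
    norming functional is replaced by one that attains its norm nearby, and only
    its value at the single vector [y] is controlled.  Take [g] supporting the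
    norm at [z = x - t y].  Then [t g(y) = g(x) - g(z) <= 1 - |z|] while
    [|z| >= f(z) >= 1 - t e - t f(y)]. *)
Lemma attaining_perturbation (X : normedModType R) (x y : X)
    (f : {linear X -> R^o}) (t e : R) :
  `|x| = 1 -> `|y| = 1 -> dual_sphere f -> 0 < t -> t < 1 ->
  1 - t * e <= f x ->
  exists u (g : {linear X -> R^o}), [/\ `|u| = 1, dual_sphere g, g u = 1,
    `|x - u| <= 2 * t & g y <= f y + e].
Proof.
move=> x1 y1 fS t0 t1 fx.
pose z := x - t *: y.
have ty : `|t *: y| = t by rewrite normrZ y1 mulr1 ger0_norm// ltW.
have zx : `|z| <= 1 + t by rewrite (le_trans (ler_normB _ _))// x1 ty.
have xz : 1 - t <= `|z|.
  have := ler_normD z (t *: y); rewrite /z subrK x1 ty => h; lra.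
have z0 : 0 < `|z| by lra.
have [|g gS gz] := @norming_functional X z; first by rewrite -normr_gt0.
exists (`|z|^-1 *: z), g; split=> //.
- by rewrite normrZ normfV normr_id mulVf ?gt_eqF.
- by rewrite linearZ /= gz -[_ *: _]/(_ * _) mulVf ?gt_eqF.
- set u := _ *: z.
  have -> : x - u = t *: y + (z - u) by rewrite addrA [t *: y + z]addrC subrK.
  apply: (le_trans (ler_normD _ _)); rewrite ty.
  have -> : z - u = (1 - `|z|^-1) *: z by rewrite scalerBl scale1r.
  rewrite normrZ -[X in _ * X](ger0_norm (normr_ge0 z)) -normrM mulrBl mul1r.
  rewrite mulVf ?gt_eqF//.
  have : `| `|z| - 1| <= t by rewrite ler_norml; apply/andP; split; lra.
  by move=> h; lra.
have h1 : g z = g x - t * g y by rewrite /z linearB linearZ.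
have h2 : f z = f x - t * f y by rewrite /z linearB linearZ.
have h3 : g x <= 1 by rewrite -x1; exact: dual_sphere_le.
have h4 : f z <= `|z| by exact: dual_sphere_le.
by rewrite -(ler_pM2l t0) mulrDr; lra.
Qed.

(** The perturbation parameter [t] is fixed from [d] so that the perturbed
    vector still satisfies [|u + y| >= 2 (1 - d)]; only then is [f x] required
    to be within [t e / 2] of [1]. *)
Lemma uacs_of_attaining (X : completeNormedModType R) :
  (forall e : R, 0 < e -> exists2 d : R, 0 < d &
    forall (x y : X) (f : {linear X -> R^o}), `|x| = 1 -> `|y| = 1 ->
      dual_sphere f -> f x = 1 -> 2 * (1 - d) <= `|x + y| -> 1 - e <= f y) ->
  uacs X.
Proof.
move=> H x y f x1 y1 fS xy2 fx1; apply/cvgrPdist_le => e e0.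
have e20 : 0 < e / 2 by lra.
have [d d0 Hd] := H _ e20.
pose t := Num.min (d / 2) (1 / 2).
have t0 : 0 < t by rewrite lt_min; apply/andP; split; lra.
have [td t1] : t <= d / 2 /\ t <= 1 / 2.
  by split; rewrite ge_min lexx ?orbT.
near=> n.
have fy1 : f n (y n) <= 1 by rewrite -(y1 n); exact: dual_sphere_le.
rewrite ger0_norm ?subr_ge0//.
have fxn : 1 - t * (e / 2) <= f n (x n).
  have : `|1 - f n (x n)| <= t * (e / 2).
    by near: n; move/cvgrPdist_le: fx1; apply; rewrite mulr_gt0.
  by move=> /(le_trans (ler_norm _)) h; lra.
have xyn : 2 - d <= `|x n + y n|.
  have : `|2 - `|x n + y n| | <= d by near: n; move/cvgrPdist_le: xy2; apply.
  by move=> /(le_trans (ler_norm _)) h; lra.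
have [|u [g [u1 gS gu xu gy]]] :=
  attaining_perturbation (x1 n) (y1 n) (fS n) t0 _ fxn; first by lra.
have uy : 2 * (1 - d) <= `|u + y n|.
  have := ler_normD (x n - u) (u + y n); rewrite addrA subrK => h; lra.
have := Hd u (y n) g u1 (y1 n) gS gu uy; lra.
Unshelve. all: by end_near. Qed.

End dual.

(** * The inequality in one summand *)

Section opnorm.
Context {R : realType} {X : normedModType R}.
Implicit Types (g : {linear X -> R^o}) (x : X).

(** Absolute values are left out: they do not change the supremum over a
    symmetric ball. *)
Definition opnorm g : R :=
  sup [set (g x : R) | x in [set x : X | `|x| <= 1]].

Section bounded.
Variables (g : {linear X -> R^o}) (C : R) (gC : forall x, g x <= C * `|x|).

Let has_sup_opnorm : has_sup [set (g x : R) | x in [set x : X | `|x| <= 1]].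
Proof.
split; first by exists (g 0), 0 => //=; rewrite normr0.
exists `|C| => _ [x /= x1 <-]; apply: (le_trans (gC x)).
apply: le_trans (ler_wpM2r (normr_ge0 _) (ler_norm C)) _.
by rewrite ler_piMr.
Qed.

Lemma opnorm_ge0 : 0 <= opnorm g.
Proof.
rewrite -(linear0 g); apply: ub_le_sup; first by case: has_sup_opnorm.
by exists 0 => //=; rewrite normr0.
Qed.

Lemma le_opnorm x : g x <= opnorm g * `|x|.
Proof.
have [->|x0] := eqVneq x 0; first by rewrite linear0 normr0 mulr0.
have nx0 : 0 < `|x| by rewrite normr_gt0.
rewrite -ler_pdivrMr// mulrC -[_ * _]/(`|x|^-1 *: (g x : R^o)) -linearZ.
apply: ub_le_sup; first by case: has_sup_opnorm.
by exists (`|x|^-1 *: x) => //=; rewrite normrZ normfV normr_id mulVf ?gt_eqF.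
Qed.

Lemma opnorm_adherent (e : R) : 0 < e ->
  exists2 x, `|x| <= 1 & opnorm g - e < g x.
Proof.
by move=> e0; have [_ [x /= x1 <-] h] := sup_adherent e0 has_sup_opnorm; exists x.
Qed.

Lemma opnorm_normalise : 0 < opnorm g ->
  exists2 h : {linear X -> R^o}, dual_sphere h & forall x, g x = opnorm g * h x.
Proof.
move=> c0; have c0' : opnorm g != 0 by rewrite gt_eqF.
have [x y|k x|h hE] := @linear_of_fun R X (fun x => (opnorm g)^-1 * g x).
- by rewrite linearD mulrDr.
- by rewrite linearZ /= -[_ *: _]/(_ * _) mulrCA.
exists h => [|x]; last by rewrite hE mulVKf.
apply/dual_sphereP; split=> [x|e e0].
  by rewrite hE ler_pdivrMl// le_opnorm.
have [x x1 gx] := opnorm_adherent (mulr_gt0 c0 e0).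
by exists x => //; rewrite hE ltr_pdivlMl// mulrBr mulr1.
Qed.

End bounded.
End opnorm.

Section defect.
Context {R : realType}.

(** Says that [d] is a lower bound of [delta_uacs X eps]. *)
Definition uacs_modulus (X : normedModType R) (eps d : R) :=
  forall (x y : X) (h : {linear X -> R^o}), `|x| = 1 -> `|y| = 1 ->
    dual_sphere h -> h x = 1 -> h y <= 1 - eps -> `|x + y| <= 2 * (1 - d).

Lemma uacs_modulus_of_inf (I : choiceType) (X : I -> completeNormedModType R)
    (eps : R) :
  (0 < ereal_inf [set delta_uacs (X i) eps | i in [set: I]])%E ->
  exists2 d : R, 0 < d & forall i, uacs_modulus (X i) eps d.
Proof.
set m := ereal_inf _ => m0.
have [d d0 dm] : exists2 d : R, 0 < d & (d%:E <= m)%E.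
  case: m m0 => [r r0|_|//]; first by exists r.
  by exists 1; rewrite ?leey.
exists d => // i x y h x1 y1 hS hx hy.
have : (d%:E <= (1 - `|2^-1 *: (x + y)|)%:E)%E.
  apply: (le_trans dm); apply: le_trans (ereal_inf_lbound _) _.
    by exists i.
  apply: ereal_inf_lbound; exists (x, y) => //; split=> //; split=> //.
  by exists h.
by rewrite lee_fin normrZ ger0_norm ?invr_ge0// => ?; lra.
Qed.

(** Unless [g] already sees that [y] points in a direction near [x], the
    modulus makes [|x + y|] smaller than [|x| + |y|] by at least
    [2 d min(|x|, |y|)], and the trivial estimate
    [c|x| - g(y) <= c(|x| + |y|) = c(||x| - |y|| + 2 min(|x|, |y|))] is paid for
    by that defect. *)
Lemma le_opnorm_defect (X : normedModType R) (eps d C : R)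
    (g : {linear X -> R^o}) (x y : X) :
  0 <= eps -> 0 < d -> uacs_modulus X eps d -> (forall x, g x <= C * `|x|) ->
  g x = opnorm g * `|x| ->
  opnorm g * `|x| - g y <= opnorm g *
    (`| `|x| - `|y| | + eps * `|y| + (`|x| + `|y| - `|x + y|) / d).
Proof.
move=> eps0 d0 mX gC gx.
have c0 := opnorm_ge0 gC.
have defect0 : 0 <= (`|x| + `|y| - `|x + y|) / d.
  by apply: divr_ge0 (ltW d0); rewrite subr_ge0 ler_normD.
have y_eps : 0 <= eps * `|y| by rewrite mulr_ge0.
have gy : - g y <= opnorm g * `|y|.
  by rewrite -[- g y]linearN -(normrN y); exact: le_opnorm.
have := ler_norm (`|x| - `|y|); have := ler_norm (`|y| - `|x|).
rewrite distrC; set r := `| _ - _| => r1 r2.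
set D := _ / d in defect0 *.
have [c_0|cN0] := eqVneq (opnorm g) 0.
  by move: gy; rewrite c_0 !mul0r sub0r.
have [xE|xN0] := eqVneq x 0.
  have nx : `|x| = 0 by rewrite xE normr0.
  rewrite nx in r1 *; rewrite mulr0 sub0r (le_trans gy)// ler_wpM2l//; lra.
have [yE|yN0] := eqVneq y 0.
  have ny : `|y| = 0 by rewrite yE normr0.
  rewrite yE linear0 subr0 ler_wpM2l//; move: y_eps r2; rewrite yE normr0; lra.
have {cN0}cp : 0 < opnorm g by rewrite lt_neqAle eq_sym cN0.
have [h hS gh] := opnorm_normalise gC cp.
have a0 : 0 < `|x| by rewrite normr_gt0.
have b0 : 0 < `|y| by rewrite normr_gt0.
rewrite gh -mulrBr ler_wpM2l//.
pose u := `|x|^-1 *: x; pose v := `|y|^-1 *: y.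
have xE : x = `|x| *: u by rewrite scalerA divff ?scale1r ?gt_eqF.
have yE : y = `|y| *: v by rewrite scalerA divff ?scale1r ?gt_eqF.
have u1 : `|u| = 1 by rewrite normrZ normfV normr_id mulVf ?gt_eqF.
have v1 : `|v| = 1 by rewrite normrZ normfV normr_id mulVf ?gt_eqF.
have hy : h y = `|y| * h v by rewrite [in LHS]yE linearZ.
(* the harmless case: [h] sees [v] near [u] *)
have [hv|hv] := lerP (h v) (1 - eps); last first.
  have : `|y| * (1 - eps) <= h y by rewrite hy ler_pM2l// ltW.
  by move=> ?; lra.
have hu : h u = 1.
  have hx : h x = `|x| by apply: (mulfI (lt0r_neq0 cp)); rewrite -gh gx.
  by rewrite linearZ /= hx -[_ *: _]/(_ * _) mulVf ?gt_eqF.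
clearbody u v.
have uv := mX _ _ _ u1 v1 hS hu hv.
have hy_ge : - h y <= `|y|.
  by rewrite -[- h y]linearN -(normrN y); exact: dual_sphere_le.
(* subtract the shorter of the two lengths from both vectors and use the
   modulus on what is left of [u + v] *)
pose m := Num.min `|x| `|y|.
have [mx my] : m <= `|x| /\ m <= `|y| by split; rewrite ge_min lexx ?orbT.
have m0 : 0 <= m by rewrite le_min !ltW.
have mE : `|x| + `|y| <= 2 * m + r.
  by rewrite /m; case: (leP `|x| `|y|) => _; lra.
have xy : `|x + y| <= m * (2 * (1 - d)) + (`|x| - m) + (`|y| - m).
  have -> : x + y = m *: (u + v) + (`|x| - m) *: u + (`|y| - m) *: v.
    rewrite !scalerBl -xE -yE scalerDr.
    rewrite -addrA addrACA [m *: u + _]addrC subrK.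
    by rewrite [m *: v + _]addrC subrK.
  apply: (le_trans (ler_normD _ _)); rewrite normrZ v1 mulr1 ger0_norm ?subr_ge0//.
  apply: lerD => //; apply: (le_trans (ler_normD _ _)).
  rewrite !normrZ u1 mulr1 !ger0_norm ?subr_ge0//.
  by apply: lerD => //; exact: ler_wpM2l.
have mD : 2 * m <= D by rewrite ler_pdivlMr//; lra.
lra.
Qed.

End defect.

(** * Finite partial sums *)

Section finite_sums.
Context {R : realType} {I : choiceType}.
Implicit Types (E : abs_space R I) (A : {fset I}) (a b c u : I -> R).

Lemma ler_enorm E a b : E a -> (forall i, `|b i| <= `|a i|) ->
  enorm E b <= enorm E a.
Proof. by move=> Ea ba; have [] := enorm_solid Ea ba. Qed.

Lemma esum_leP u (K : R) :
  (\esum_(i in [set: I]) (u i)%:E <= K%:E)%E <->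
  forall A, \sum_(i <- A) u i <= K.
Proof.
split=> [uK A|uK].
  rewrite -lee_fin; apply: le_trans uK; apply: ereal_sup_ubound.
  exists [set` A]; first by split.
  by rewrite fsbig_finite//= set_fsetK -sumEFin.
apply: ge_ereal_sup => _ [B [finB _] <-].
by rewrite fsbig_finite// sumEFin lee_fin.
Qed.

Definition assoc_ball E c := forall b, E b -> enorm E b <= 1 ->
  forall A, \sum_(i <- A) `|c i * b i| <= 1.

Lemma assoc_norm_eq1 E c b : assoc_ball E c -> E b -> enorm E b <= 1 ->
  (forall e : R, 0 < e -> exists A, 1 - e < \sum_(i <- A) `|c i * b i|) ->
  assoc_norm E c = 1%E.
Proof.
move=> cE Eb b1 cb; apply/eqP; rewrite eq_le; apply/andP; split.
  apply: ge_ereal_sup => _ [b' [Eb' b'1] <-].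
  by apply/esum_leP; exact: cE.
apply/lee_addgt0Pr => e e0; have [A hA] := cb _ e0.
rewrite -leeBlDr// -EFinB.
apply: (@le_trans _ _ (\esum_(i in [set: I]) `|c i * b i|%:E)%E); last first.
  by apply: ereal_sup_ubound; exists b.
apply: esum_ge; exists [set` A]; first by split.
by rewrite fsbig_finite//= set_fsetK sumEFin lee_fin ltW.
Qed.

Lemma partial_sum_cvg1 u : (forall i, 0 <= u i) ->
  (forall A, \sum_(i <- A) u i <= 1) ->
  (forall e : R, 0 < e -> exists A, 1 - e < \sum_(i <- A) u i) ->
  summability.partial_sum u @ summability.totally --> (1 : R).
Proof.
move=> u0 u1 ue; have totally_filter := @summability.totally_filter I.
apply/cvgrPdist_lt => e e0; have [A hA] := ue _ e0.
exists A => // B /= AB; rewrite /summability.partial_sum -(big_seq_fsetE _ B xpredT u).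
rewrite ger0_norm ?subr_ge0//.
suff : \sum_(i <- A) u i <= \sum_(i <- B) u i by move=> ?; lra.
rewrite (big_fsetID _ (mem A) B)/= .
have -> : [fset x in B | x \in A]%fset = A.
  apply/fsetP => i; rewrite !inE andbC.
  by case: (boolP (i \in A)) => //= /(fsubsetP AB).
by rewrite lerDl sumr_ge0.
Qed.

(** The partial sums of a nonnegative pairing increase along the finite sets,
    so one finite set with sum above [1 - e] for each [e] already gives the
    convergence of the net that [(u^+)] asks for. *)
Lemma u_plus_finite E : u_plus E -> forall eps : R, 0 < eps ->
  exists2 delta : R, 0 < delta & forall a b c,
    E a -> enorm E a = 1 -> E b -> enorm E b = 1 -> assoc_ball E c ->
    (forall i, 0 <= a i) -> (forall i, 0 <= c i) ->
    (forall e : R, 0 < e -> exists A, 1 - e < \sum_(i <- A) a i * c i) ->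
    2 * (1 - delta) <= enorm E (a + b) ->
    forall A, \sum_(i <- A) c i * `|a i - b i| <= eps.
Proof.
move=> uE eps eps0; have [d d0 H] := uE _ eps0; exists d => // a b c.
move=> Ea a1 Eb b1 cE a0 c0 ac ab.
have caE i : `|c i * a i| = a i * c i by rewrite ger0_norm ?mulr_ge0// mulrC.
have acE A : \sum_(i <- A) `|c i * a i| = \sum_(i <- A) a i * c i by exact: eq_bigr.
have cN : assoc_norm E c = 1%E.
  apply: (assoc_norm_eq1 cE Ea); first by rewrite a1.
  by move=> e /ac [A hA]; exists A; rewrite acE.
have ac1 : summability.partial_sum (fun i => a i * c i) @ summability.totally
    --> (1 : R).
  apply: partial_sum_cvg1 => // [i|A]; first exact: mulr_ge0.
  by rewrite -acE; apply: cE => //; rewrite a1.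
have := H a b c Ea a1 Eb b1 cN ac1 ab.
move=> /esum_leP h A; apply: le_trans (h A).
by apply: ler_sum => i _; rewrite (ger0_norm (c0 i)).
Qed.

End finite_sums.

(** * Functionals on an absolute sum *)

Section injection.
Context {R : realType} {I : choiceType}.
Variables (E : abs_space R I) (X : I -> completeNormedModType R).
Local Notation sumX := (abs_sum E X).

Let single i (z : X i) : forall j, X j := eqtype.dfwith (fun j => 0 : X j) z.

Let norm_single i (z : X i) :
  (fun j => `|single z j|) = `|z| *: unit_vec R i.
Proof.
apply/funext => j; rewrite -[RHS]/(`|z| * (j == i)%:R) /single.
case: eqtype.dfwithP => [|k ik]; first by rewrite eqxx mulr1.
by rewrite normr0 eq_sym (negbTE ik) mulr0.
Qed.

Let single_carrier i (z : X i) : E (fun j => `|single z j|).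
Proof. by rewrite norm_single; apply: carrierZ; exact: carrier_unit. Qed.

Definition inj i (z : X i) : sumX := AbsSum (single_carrier z).

Lemma injE i (z : X i) : inj z i = z.
Proof. exact: dfwith_in. Qed.

Lemma inj_out i (z : X i) j : j != i -> inj z j = 0.
Proof. by move=> ji; apply: dfwith_out; rewrite eq_sym. Qed.

Lemma norm_inj i (z : X i) : `|inj z| = `|z|.
Proof.
rewrite abs_sum_normE norm_single enormZ; last exact: carrier_unit.
by rewrite normr_id enorm_unit mulr1.
Qed.

Lemma inj_is_linear i : linear (@inj i).
Proof.
move=> k y z; apply: abs_sum_eq => j.
change (inj (k *: y + z) j = k *: inj y j + inj z j).
have [->|ji] := eqVneq j i; first by rewrite !injE.
by rewrite !inj_out// scaler0 addr0.
Qed.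

HB.instance Definition _ i :=
  GRing.isLinear.Build R (X i) sumX *:%R (@inj i) (@inj_is_linear i).

Definition coord_fun (f : {linear sumX -> R^o}) i : {linear X i -> R^o} :=
  f \o @inj i.

Definition trunc (A : {fset I}) (w : forall i, X i) : sumX :=
  \sum_(i <- A) inj (w i).

Lemma truncE A w j : trunc A w j = if j \in A then w j else 0.
Proof.
have sumE (s : seq I) : (\sum_(i <- s) inj (w i)) j = \sum_(i <- s) inj (w i) j.
  elim: s => [|i s ih]; first by rewrite !big_nil.
  by rewrite !big_cons -ih.
rewrite /trunc sumE; case: ifPn => jA.
  rewrite (big_fsetD1 _ jA) injE big_seq big1 => [|i]; first exact: addr0.
  by rewrite !inE => /andP[ij _]; rewrite inj_out// eq_sym.
by rewrite big_seq big1// => i iA; rewrite inj_out//; apply: contraNneq jA => ->.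
Qed.

Lemma fun_trunc (f : {linear sumX -> R^o}) A w :
  f (trunc A w) = \sum_(i <- A) coord_fun f i (w i).
Proof. by rewrite linear_sum. Qed.

(** Outside the support of a finite combination approximating [(|w_i|)], the
    truncated tail of [w] is dominated by the error of that approximation. *)
Lemma trunc_dense : units_dense E -> forall (w : sumX) (e : R), 0 < e ->
  exists A0 : {fset I}, forall A : {fset I}, {subset A0 <= A} ->
    `|w - trunc A w| < e.
Proof.
move=> dE w e e0; have [s [k hs]] := dE _ (fam_carrier w) _ e0.
exists [fset i in s]%fset => A sA; apply: le_lt_trans hs.
rewrite abs_sum_normE; apply: ler_enorm.
  apply: carrierB; first exact: fam_carrier.
  elim: s {sA} => [|i s ih]; first by rewrite big_nil; exact: carrier0.
  by rewrite big_cons; apply: carrierD => //; apply: carrierZ; exact: carrier_unit.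
move=> i; rewrite normr_id abs_sumBE truncE; case: ifPn => iA.
  by rewrite subrr normr0.
rewrite subr0 -[X in _ <= `|X|]/(`|w i| - (\sum_(j <- s) k j *: unit_vec R j) i).
have is_ : i \notin s by apply: contra iA => is_; apply: sA; rewrite !inE.
suff -> : (\sum_(j <- s) k j *: unit_vec R j) i = 0 by rewrite subr0 normr_id.
elim: s is_ {sA} => [|j s ih]; first by rewrite big_nil.
rewrite inE negb_or big_cons => /andP[ij /ih {}ih].
rewrite -[LHS]/(k j * (i == j)%:R + (\sum_(j <- s) k j *: unit_vec R j) i) ih.
by rewrite (negbTE ij) mulr0 addr0.
Qed.

Section functional.
Variables (f : {linear sumX -> R^o}) (f_le : forall x, f x <= `|x|).

Lemma coord_fun_le i z : coord_fun f i z <= 1 * `|z|.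
Proof. by rewrite mul1r -norm_inj; exact: f_le. Qed.

Let c i := opnorm (coord_fun f i).

Lemma fun_le_sum (w : sumX) (e : R) : units_dense E -> 0 < e ->
  exists A0 : {fset I}, forall A : {fset I}, {subset A0 <= A} ->
    f w <= \sum_(i <- A) coord_fun f i (w i) + e.
Proof.
move=> dE e0; have [A0 hA] := trunc_dense dE w e0; exists A0 => A /hA h.
have := le_lt_trans (f_le (w - trunc A w)) h.
rewrite linearB fun_trunc -[_ - _]/((f w : R) - _) => ?; lra.
Qed.

(** Choose [z_i] in the unit ball almost norming [f] on the [i]-th summand; the
    vector with entries [|b_i| z_i] over a finite set has norm at most [|b|] and
    [f] sends it nearly to the sum of the [c_i |b_i|]. *)
Lemma opnorm_coord_assoc_ball : assoc_ball E c.
Proof.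
move=> b Eb b1 A; apply/ler_addgt0Pr => e e0.
set S := \sum_(i <- A) `|b i|.
have S0 : 0 <= S by rewrite sumr_ge0.
(* [S + 1] rather than [S], which may vanish *)
have e'0 : 0 < e / (S + 1) by rewrite divr_gt0// ltr_wpDl.
have z_ex i : {z : X i | `|z| <= 1 /\ c i - e / (S + 1) < coord_fun f i z}.
  by apply: cid; have [z] := opnorm_adherent (@coord_fun_le i) e'0; exists z.
pose z i := sval (z_ex i).
have hz i : `|z i| <= 1 /\ c i - e / (S + 1) < coord_fun f i (z i) :=
  svalP (z_ex i).
have zA : `|trunc A (fun i => `|b i| *: z i)| <= 1.
  apply: le_trans b1; rewrite abs_sum_normE; apply: ler_enorm => // i.
  rewrite normr_id truncE; case: ifP => _; last by rewrite normr0.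
  by rewrite normrZ normr_id ler_piMr//; case: (hz i).
have := le_trans (f_le _) zA; rewrite fun_trunc => fz1.
have : \sum_(i <- A) `|c i * b i| <=
    \sum_(i <- A) coord_fun f i (`|b i| *: z i) +
    \sum_(i <- A) e / (S + 1) * `|b i|.
  rewrite -big_split; apply: ler_sum => i _.
  rewrite normrM (ger0_norm (opnorm_ge0 (@coord_fun_le i))).
  change (c i * `|b i| <= coord_fun f i (`|b i| *: z i) + e / (S + 1) * `|b i|).
  have -> : coord_fun f i (`|b i| *: z i) = `|b i| * coord_fun f i (z i).
    exact: (linearZ_LR (coord_fun f i)).
  rewrite mulrC [e / _ * _]mulrC -mulrDr.
  by rewrite ler_wpM2l// -lerBlDr ltW//; case: (hz i).
rewrite -mulr_sumr -/S => /le_trans; apply; apply: lerD => //.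
rewrite mulrAC ler_pdivrMr ?ltr_wpDl//; have := mulr_ge0 (ltW e0) S0.
by rewrite mulrDr mulr1 => ?; lra.
Qed.

(** There is no slack in [1 = f w <= sum c_i |w_i| <= 1], while each term of
    the first sum is at most the corresponding [c_i |w_i|]. *)
Lemma coord_fun_norming (w : sumX) : units_dense E -> `|w| = 1 -> f w = 1 ->
  (forall i, coord_fun f i (w i) = c i * `|w i|) /\
  (forall e : R, 0 < e ->
    exists A : {fset I}, 1 - e < \sum_(i <- A) `|w i| * c i).
Proof.
move=> dE w1 fw.
have le_c i : coord_fun f i (w i) <= c i * `|w i|.
  exact: le_opnorm (@coord_fun_le i) _.
split=> [i|e e0]; last first.
  have e20 : 0 < e / 2 by lra.
  have [A /(_ A (fun=> id))] := fun_le_sum w dE e20; rewrite fw => h.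
  exists A; have : \sum_(i <- A) coord_fun f i (w i) <= \sum_(i <- A) `|w i| * c i.
    by apply: ler_sum => i _; rewrite mulrC.
  by move=> ?; lra.
apply/eqP; rewrite eq_le le_c/=; apply/ler_addgt0Pr => e e0.
have [A0 hA] := fun_le_sum w dE e0.
pose A := (i |` A0)%fset; have {hA} := hA A.
have /[swap] /[apply] : {subset A0 <= A} by move=> j; apply: fset1Ur.
rewrite fw => h1.
have wE : enorm E (fun i => `|w i|) <= 1 by rewrite -abs_sum_normE w1.
have h2 : \sum_(i <- A) c i * `|w i| <= 1.
  have := opnorm_coord_assoc_ball (fam_carrier w) wE A.
  by apply: le_trans; apply: ler_sum => j _; exact: ler_norm.
have iA : i \in A by rewrite !inE eqxx.
move: h1 h2; rewrite (big_fsetD1 i)//= (big_fsetD1 i iA)/= => h1 h2.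
have : \sum_(j <- (A `\ i)%fset) coord_fun f j (w j) <=
    \sum_(j <- (A `\ i)%fset) c j * `|w j| by apply: ler_sum.
by move=> ?; lra.
Qed.

End functional.
End injection.

(** * The absolute sum is uacs *)

Section absolute_sum.
Context {R : realType} {I : choiceType}.
Variables (E : abs_space R I) (X : I -> completeNormedModType R).
Local Notation sumX := (abs_sum E X).

(** Put [a = (|x_i|)] and [b' = (|x_i + y_i| - |x_i|)].  Then [|b'_i| <= |y_i|]
    and [a + b'] has the norm of [x + y], so [b'] nearly lies on the sphere of
    [E]; its normalisation inherits the estimate [2 (1 - delta) <= |a + b'|]. *)
Lemma enorm_add_normalise (x y : sumX) (d : R) : `|x| = 1 -> `|y| = 1 ->
  d < 1 / 2 -> 2 * (1 - d) <= `|x + y| ->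
  exists (N : R) b, [/\ E b, enorm E b = 1, 0 <= 1 - N <= 2 * d,
    2 * (1 - 2 * d) <= enorm E ((fun i => `|x i|) + b) &
    forall i, `|x i + y i| = `|x i| + N * b i].
Proof.
move=> x1 y1 d2 xy.
pose a i := `|x i|; pose z i := `|x i + y i|.
have Ea : E a by exact: fam_carrier.
have Ez : E z by exact: (fam_carrier (x + y)).
have nz : 2 * (1 - d) <= enorm E z by exact: xy.
have Ez_a : E (z - a) by exact: carrierB.
have za_y : enorm E (z - a) <= 1.
  rewrite -y1 abs_sum_normE; apply: ler_enorm; first exact: fam_carrier.
  move=> i; rewrite normr_id -[(z - a) i]/(`|x i + y i| - `|x i|).
  by apply: le_trans (ler_dist_dist _ _) _; rewrite addrAC subrr add0r.
set N := enorm E (z - a) in za_y.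
have N1 : 1 - N <= 2 * d.
  have := ler_enormD Ea Ez_a; rewrite addrC subrK -/N -[enorm E a]/(`|x|) x1.
  by move=> ?; lra.
have N0 : 0 < N by lra.
pose b := N^-1 *: (z - a).
have Eb : E b by exact: carrierZ.
have Nb : N *: b = z - a by rewrite scalerA divff ?scale1r// gt_eqF.
have b1 : enorm E b = 1.
  by rewrite enormZ// -/N ger0_norm ?invr_ge0 ?ltW// mulVf// gt_eqF.
exists N, b; split=> //; first by rewrite subr_ge0 za_y.
  have Eb1 : E ((N - 1) *: b) by exact: carrierZ.
  have := ler_enormD (carrierD Ea Eb) Eb1.
  have -> : a + b + (N - 1) *: b = z.
    by rewrite scalerBl scale1r Nb -[z - a - b]addrA -opprD [a + b + _]addrC subrK.
  rewrite enormZ// b1 mulr1 ler0_norm ?subr_le0// => ?; lra.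
move=> i; have := congr1 (@^~ i) Nb.
rewrite -[(N *: b) i]/(N * b i) -[(z - a) i]/(`|x i + y i| - `|x i|) => ->.
by rewrite [RHS]addrC subrK.
Qed.

(** On a finite set carrying almost all of [f (x - y)], the term
    [|x_i| + |y_i| - |x_i + y_i|] of the inequality in the [i]-th summand is
    [(|y_i| - |x_i|) + (|x_i| - b_i) + (1 - N) b_i], whose first two parts are
    controlled by [(u^+)] and whose last part has the factor [1 - N <= 2 t]. *)
Lemma abs_sum_attaining : units_dense E ->
  (forall eps : R, 0 < eps -> eps <= 2 ->
    exists2 d : R, 0 < d & forall i, uacs_modulus (X i) eps d) ->
  u_plus E ->
  forall e : R, 0 < e -> exists2 d : R, 0 < d &
    forall (x y : sumX) (f : {linear sumX -> R^o}), `|x| = 1 -> `|y| = 1 ->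
      dual_sphere f -> f x = 1 -> 2 * (1 - d) <= `|x + y| -> 1 - e <= f y.
Proof.
move=> dE mX uE e e0.
(* The bound reached for [1 - f y] is
   [k + eps + 2 k / d + 2 t / d + e / 8 <= 7 e / 8], where [k] is the bound
   obtained from [(u^+)] and [t] the defect of [|x + y|]. *)
pose eps := Num.min (e / 4) 2.
have eps0 : 0 < eps by rewrite lt_min; apply/andP; split; lra.
have [eps_e eps2] : eps <= e / 4 /\ eps <= 2 by split; rewrite ge_min lexx ?orbT.
have [d d0 md] := mX _ eps0 eps2.
have ed0 : 0 < e * d / 16 by rewrite divr_gt0// mulr_gt0.
pose k := Num.min (e / 4) (e * d / 16).
have k0 : 0 < k by rewrite lt_min ed0 andbT; lra.
have [k_e k_d] : k <= e / 4 /\ k <= e * d / 16 by split; rewrite ge_min lexx ?orbT.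
have [du du0 Hu] := u_plus_finite uE k0.
pose t := Num.min (Num.min (du / 2) (1 / 4)) (e * d / 16).
have t0 : 0 < t by rewrite !lt_min ed0 andbT; apply/andP; split; lra.
have [t_u t_1 t_d] : [/\ t <= du / 2, t <= 1 / 4 & t <= e * d / 16].
  by split; rewrite !ge_min lexx ?orbT.
exists t => // x y f x1 y1 fS fx xy.
have f_le w : f w <= `|w| by exact: dual_sphere_le.
have [|N [b [Eb b1 /andP[N1 N2] ab zN]]] :=
  enorm_add_normalise x1 y1 _ xy; first by lra.
pose c i := opnorm (coord_fun f i).
have c0 i : 0 <= c i by exact: opnorm_ge0 (coord_fun_le f_le (i := i)).
have cE : assoc_ball E c by exact: opnorm_coord_assoc_ball.
have [cx ac] := coord_fun_norming f_le dE x1 fx.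
have Ex := fam_carrier x; have Ey := fam_carrier y.
have x0 i : 0 <= `|x i| by [].
have sum_xb (A : {fset I}) : \sum_(i <- A) c i * `| `|x i| - b i| <= k.
  refine (Hu (fun i => `|x i|) b c Ex x1 Eb b1 cE x0 c0 ac _ A).
  by apply: le_trans ab; lra.
have sum_xy (A : {fset I}) : \sum_(i <- A) c i * `| `|x i| - `|y i| | <= k.
  refine (Hu (fun i => `|x i|) (fun i => `|y i|) c Ex x1 Ey y1 cE x0 c0 ac _ A).
  have : `|x + y| <= enorm E ((fun i => `|x i|) + (fun i => `|y i|)).
    rewrite abs_sum_normE; apply: ler_enorm; first exact: carrierD.
    move=> i; rewrite normr_id; apply: le_trans (ler_normD _ _) _.
    exact: (ler_norm (`|x i| + `|y i|)).
  by move=> ?; lra.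
have sum_c v (A : {fset I}) : E v -> enorm E v = 1 -> \sum_(i <- A) c i * `|v i| <= 1.
  move=> Ev v1; have := cE v Ev _ A; rewrite v1 lexx => /(_ isT).
  rewrite (eq_bigr _ (fun i _ => normrM _ _)).
  by under eq_bigr do rewrite (ger0_norm (c0 _)).
have e80 : 0 < e / 8 by lra.
have [A /(_ A (fun=> id))] := fun_le_sum f_le (x - y) dE e80.
rewrite linearB -[_ - _]/((f x : R) - f y) fx => fy.
pose S1 := \sum_(i <- A) c i * `| `|x i| - `|y i| |.
pose S2 := \sum_(i <- A) c i * `| `|x i| - b i|.
pose S3 := \sum_(i <- A) c i * `| `|y i| |.
pose S4 := \sum_(i <- A) c i * `|b i|.
have S1k : S1 <= k by exact: sum_xy.
have S2k : S2 <= k by exact: sum_xb.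
have S31 : S3 <= 1 by exact: (sum_c (fun i => `|y i|)).
have S41 : S4 <= 1 by exact: sum_c.
have S30 : 0 <= S3 by apply: sumr_ge0 => i _; exact: mulr_ge0.
have S40 : 0 <= S4 by apply: sumr_ge0 => i _; exact: mulr_ge0.
have sumf : \sum_(i <- A) coord_fun f i ((x - y) i) <=
    (1 + d^-1) * S1 + d^-1 * S2 + eps * S3 + (1 - N) * d^-1 * S4.
  rewrite /S1 /S2 /S3 /S4 !mulr_sumr -!big_split; apply: ler_sum => i _.
  change (coord_fun f i (x i - y i) <= (1 + d^-1) * (c i * `| `|x i| - `|y i| |) +
    d^-1 * (c i * `| `|x i| - b i|) + eps * (c i * `| `|y i| |) +
    (1 - N) * d^-1 * (c i * `|b i|)).
  have -> : coord_fun f i (x i - y i) = c i * `|x i| - coord_fun f i (y i).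
    by rewrite -cx; exact: linearB.
  have := le_opnorm_defect (y i) (ltW eps0) d0 (md i)
    (coord_fun_le f_le (i := i)) (cx i).
  rewrite -/(c i) normr_id => /le_trans; apply.
  have defect : `|x i| + `|y i| - `|x i + y i| <=
      `| `|x i| - `|y i| | + `| `|x i| - b i| + (1 - N) * `|b i|.
    rewrite zN; have := ler_norm (`|y i| - `|x i|); rewrite distrC.
    have := ler_norm (`|x i| - b i); have := ler_wpM2l N1 (ler_norm (b i)).
    by move=> ? ? ?; lra.
  have dV0 : 0 <= d^-1 by rewrite invr_ge0 ltW.
  have := ler_wpM2l (c0 i) (ler_wpM2r dV0 defect); lra.
have kd : k * d^-1 <= e / 16 by rewrite ler_pdivrMr//; lra.
have td : t * d^-1 <= e / 16 by rewrite ler_pdivrMr//; lra.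
have dV0 : 0 < d^-1 by rewrite invr_gt0.
have h1 : d^-1 * S1 <= k * d^-1 by rewrite mulrC ler_wpM2r// ltW.
have h2 : d^-1 * S2 <= k * d^-1 by rewrite mulrC ler_wpM2r// ltW.
have h3 : eps * S3 <= eps by rewrite ler_piMr// ltW.
have h4 : (1 - N) * d^-1 * S4 <= 2 * (t * d^-1).
  rewrite mulrA; apply: le_trans (ler_wpM2r (ltW dV0) N2).
  by rewrite ler_piMr// mulr_ge0// ltW.
lra.
Qed.

End absolute_sum.

Theorem theorem3p16 (R : realType) (I : choiceType) (i0 : I)
    (E : abs_space R I) (X : I -> completeNormedModType R) :
  units_dense E ->
  (forall eps : R, 0 < eps -> eps <= 2 ->
    (0 < ereal_inf [set delta_uacs (X i) eps | i in [set: I]])%E) ->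
  u_plus E ->
  uacs (abs_sum E X).
Proof.
move=> dE dX uE; apply: uacs_of_attaining; apply: abs_sum_attaining => //.
by move=> eps eps0 eps2; apply: uacs_modulus_of_inf; exact: dX.
Qed.
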